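(* Let $X_1,X_2,Y$ be sequence classes, let $F$ be a Banach space, and let $E_1\in\mathcal{B}(X_1,Y,F)$ and $E_2\in\mathcal{C}(X_2,Y,F)$. Then every continuous bilinear operator from $E_1\times E_2$ to $F$ is $(\mathbb{N}^2;X_1,X_2;Y,Y)$-summing. Moreover, if $\|u\|_{X_1;Y}\le C_1\|u\|$ for every $u\in\mathcal{L}(E_1;Y(F))$ and $\|v\|_{X_2;Y}\le C_2\|v\|$ for every $v\in\mathcal{L}(E_2;F)$, then $\|A\|_{\mathbb{N}^2;X_1,X_2;Y,Y}\le C_1C_2\|A\|$ for every $A\in\mathcal{L}(E_1,E_2;F)$.
   Context: All Banach spaces are over $\mathbb{K}=\mathbb{R}$ or $\mathbb{C}$; $\mathcal{L}(E;F)$ and $\mathcal{L}(E_1,E_2;F)$ are the Banach spaces of continuous linear, respectively bilinear, operators with the usual sup norm. $E\stackrel{1}{\hookrightarrow}F$ means that $E$ is a linear subspace of $F$ and $\|x\|_F\le\|x\|_E$ for every $x\in E$. $c_{00}(E)$ is the space of eventually null $E$-valued sequences, $\ell_\infty(E)$ the space of bounded $E$-valued sequences with the sup norm; $(e_j)_{j=1}^\infty$ are the canonical unit vectors of scalar sequence spaces. Sequence spaces carry the coordinatewise operations. A sequence class is a rule $X$ assigning to each Banach space $E$ a Banach space $X(E)$ of $E$-valued sequences such that $c_{00}(E)\subset X(E)\stackrel{1}{\hookrightarrow}\ell_\infty(E)$ and $\|e_j\|_{X(\mathbb{K})}=1$ for every $j$. For sequence classes $X,Y$, an operator $u\in\mathcal{L}(E;F)$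 is $(X;Y)$-summing if $(u(x_j))_{j=1}^\infty\in Y(F)$ whenever $(x_j)_{j=1}^\infty\in X(E)$. In that case the induced linear operator $\widehat{u}\colon X(E)\to Y(F)$, $\widehat{u}((x_j)_{j=1}^\infty)=(u(x_j))_{j=1}^\infty$, is continuous; $\|u\|_{X;Y}=\|\widehat{u}\|$, and $\mathcal{L}_{X;Y}(E;F)$ is the set of all such $u$. With $\mathrm{BAN}$ the class of all Banach spaces, $\mathcal{B}(X,Y,F)=\{E\in\mathrm{BAN}:\mathcal{L}(E;Y(F))=\mathcal{L}_{X;Y}(E;Y(F))\}$ and $\mathcal{C}(X,Y,F)=\{E\in\mathrm{BAN}:\mathcal{L}(E;F)=\mathcal{L}_{X;Y}(E;F)\}$. A bilinear operator $A\in\mathcal{L}(E_1,E_2;F)$ is $(\mathbb{N}^2;X_1,X_2;Y,Y)$-summing if $\left(\left(A(x^{(1)}_{j_1},x^{(2)}_{j_2})\right)_{j_2=1}^\infty\right)_{j_1=1}^\infty\in Y(Y(F))$ whenever $(x^{(1)}_j)_{j=1}^\infty\in X_1(E_1)$ and $(x^{(2)}_j)_{j=1}^\infty\in X_2(E_2)$. In that case the induced map $\widehat{A}_{\mathbb{N}^2}\colon X_1(E_1)\times X_2(E_2)\to Y(Y(F))$, sending the pair of sequences to this iterated sequence, is a continuous bilinear operator, and $\|A\|_{\mathbb{N}^2;X_1,X_2;Y,Y}=\|\widehat{A}_{\mathbb{N}^2}\|$. *)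

(* Defs.v *)
From HB Require Import structures.
From mathcomp Require Import all_boot all_order all_algebra.
From mathcomp Require Import all_classical all_reals all_analysis.
From mathcomp Require Import complex.

Set Implicit Arguments.
Unset Strict Implicit.
Unset Printing Implicit Defensive.

Import Order.TTheory GRing.Theory Num.Theory.
Import numFieldNormedType.Exports.

Local Open Scope classical_set_scope.
Local Open Scope ring_scope.

Lemma complex_complete (R : realType) (F : set_system R[i]^o) :
  ProperFilter F -> cauchy F -> cvg F.
Proof.
move=> FF /cauchy_ballP Fc.
have part (p : R[i] -> R) : (forall z w, `|p z - p w|%:C%C <= `|z - w|) ->
    exists l : R, p z @[z --> F] --> l.
  move=> ple; apply/cvg_ex; apply: R_complete.
  apply/cauchy_ballP => e e0.
  have e0' : 0 < e%:C%C by rewrite ltcR.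
  have [[/= A B] [FA FB] AB] := Fc _ e0'.
  exists (p @` A, p @` B); first split => /=.
  - by apply: filterS FA => z Az; exists z.
  - by apply: filterS FB => z Bz; exists z.
  move=> [_ _] [/= [z Az <-] [w Bw <-]].
  have := AB (z, w) (conj Az Bw).
  rewrite -!ball_normE /= => zw.
  by rewrite -ltcR; apply: le_lt_trans zw.
have [a Fa] : exists l : R, complex.Re z @[z --> F] --> l.
  apply: part => z w; rewrite -raddfB; exact: normc_ge_Re.
have [b Fb] : exists l : R, complex.Im z @[z --> F] --> l.
  apply: part => z w; rewrite -raddfB.
  case: (z - w) => u v; rewrite normc_def lecR -sqrtr_sqr.
  by apply: ler_wsqrtr; rewrite lerDr sqr_ge0.
apply/cvg_ex; exists (a +i* b)%C.
apply/cvgrPdist_lt => e e0.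
have er : e = (complex.Re e)%:C%C by apply/esym/RRe_real/gtr0_real.
have re0 : 0 < complex.Re e / 2 by rewrite divr_gt0// -ltcR -er.
near=> z.
have -> : (a +i* b)%C - z = (a - complex.Re z)%:C%C + 'i%C * (b - complex.Im z)%:C%C.
  apply/eqP; case: (z) => u v; rewrite eq_complex /= !mul0r !mulr0 !mul1r subr0 !addr0 !add0r.
  by rewrite !eqxx.
apply: (le_lt_trans (ler_normD _ _)).
rewrite normrM [`|'i%C|]normc_def /= expr0n expr1n add0r sqrtr1 mul1r.
rewrite !normc_def /= expr0n /= !addr0 !sqrtr_sqr -rmorphD/= er ltcR (splitr (complex.Re e)).
apply: ltrD.
  by near: z; move/cvgrPdist_lt: Fa; apply.
by near: z; move/cvgrPdist_lt: Fb; apply.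
Unshelve. all: by end_near.
Qed.

(* The library already keys a [Complete] instance on [_^o] (for a [realType]),
   so that of the complex scalars is attached to an alias. *)
Definition complex_banach (R : realType) : Type := R[i]^o.
HB.instance Definition _ (R : realType) :=
  NormedModule.copy (complex_banach R) R[i]^o.
HB.instance Definition _ (R : realType) :=
  Uniform_isComplete.Build (complex_banach R) (@complex_complete R).

Variant scalar_kind := real_scalars | complex_scalars.

Definition scalar_field (R : realType) (s : scalar_kind) : numFieldType :=
  match s with real_scalars => R | complex_scalars => R[i] end.

Definition scalar_banach (R : realType) (s : scalar_kind) :
    completeNormedModType (scalar_field R s) :=
  match s with
  | real_scalars => R^o : completeNormedModType R
  | complex_scalars => complex_banach R : completeNormedModType R[i]
  end.

Definition scalar_one (R : realType) (s : scalar_kind) : scalar_banach R s :=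
  match s with
  | real_scalars => (1 : R)
  | complex_scalars => (1 : R[i])
  end.

(* Library norms take values in the scalar field; [re] reads such a value as an
   element of [R]. *)
Definition re (R : realType) (s : scalar_kind) : scalar_field R s -> R :=
  match s with real_scalars => fun x => x | complex_scalars => @complex.Re R end.

(* A linear space of [E]-valued sequences together with a norm on it; the values
   of [nss_norm] outside [nss_mem] are irrelevant. *)
Record normed_seq_space (K : numFieldType) (E : normedModType K) :=
  NormedSeqSpace {
  nss_mem : {pred nat -> E} ;
  nss_norm : (nat -> E) -> K ;
  nss_submod : submod_closed nss_mem ;
  nss_normD : {in nss_mem &, forall x y,
    nss_norm (x + y) <= nss_norm x + nss_norm y} ;
  nss_normZ : forall a : K, {in nss_mem, forall x,
    nss_norm (a *: x) = `|a| * nss_norm x} ;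
  nss_norm_eq0 : {in nss_mem, forall x, nss_norm x = 0 -> x = 0} }.

Section normed_seq_space_type.
Context (K : numFieldType) (E : normedModType K) (X : normed_seq_space E).

HB.instance Definition _ :=
  GRing.isSubmodClosed.Build K (nat -> E) (nss_mem X) (nss_submod X).

Record nss_type := NssType {
  nss_seq :> nat -> E ;
  nss_seq_mem : nss_seq \in nss_mem X }.

HB.instance Definition _ := [isSub for nss_seq].
HB.instance Definition _ := [Choice of nss_type by <:].
HB.instance Definition _ := [SubChoice_isSubLmodule of nss_type by <:].

Let norm (x : nss_type) : K := nss_norm X x.

Let normD (x y : nss_type) : norm (x + y) <= norm x + norm y.
Proof. exact: nss_normD (nss_seq_mem x) (nss_seq_mem y). Qed.

Let normZ (a : K) (x : nss_type) : norm (a *: x) = `|a| * norm x.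
Proof. exact: nss_normZ (nss_seq_mem x). Qed.

Let norm_eq0 (x : nss_type) : norm x = 0 -> x = 0.
Proof. by move=> x0; apply/val_inj/(nss_norm_eq0 (nss_seq_mem x)). Qed.

HB.instance Definition _ :=
  Lmodule_isNormed.Build K nss_type normD normZ norm_eq0.

End normed_seq_space_type.

Record banach_seq_space (K : numFieldType) (E : normedModType K) :=
  BanachSeqSpace {
  bss_nss :> normed_seq_space E ;
  bss_complete : forall G : set_system (nss_type bss_nss),
    ProperFilter G -> cauchy G -> cvg G }.

Definition bss_type (K : numFieldType) (E : normedModType K)
  (X : banach_seq_space E) : Type := nss_type X.

Section banach_seq_space_type.
Context (K : numFieldType) (E : normedModType K) (X : banach_seq_space E).

HB.instance Definition _ := SubChoice.copy (bss_type X) (nss_type X).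
HB.instance Definition _ := NormedModule.copy (bss_type X) (nss_type X).
HB.instance Definition _ :=
  Uniform_isComplete.Build (bss_type X) (@bss_complete K E X).

(* The sequence [x] as an element of the space; [0] if it does not belong to
   it. *)
Definition bss_of_seq (x : nat -> E) : bss_type X := insubd 0 x.

End banach_seq_space_type.

Section sequence_classes.
Context (R : realType) (s : scalar_kind).
Local Notation K := (scalar_field R s).
Local Notation banach := (completeNormedModType K).

Definition rnorm (E : normedModType K) (x : E) : R := re `|x|.

Definition c00 (E : banach) : set (nat -> E) :=
  [set x | \forall j \near \oo, x j = 0].

Definition linfty (E : banach) : set (nat -> E) := [set x | bounded_fun x].

Definition linfty_norm (E : banach) (x : nat -> E) : R :=
  sup (range (fun j => rnorm (x j))).

Definition unit_vector (j : nat) : nat -> scalar_banach R s :=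
  fun i => if i == j then scalar_one R s else 0.

Record seq_class := SeqClass {
  sc_space :> forall E : banach, banach_seq_space E ;
  sc_c00 : forall (E : banach) (x : nat -> E),
    c00 x -> x \in nss_mem (sc_space E) ;
  sc_linfty : forall (E : banach) (x : nat -> E),
    x \in nss_mem (sc_space E) -> linfty x ;
  sc_linfty_norm : forall (E : banach) (x : bss_type (sc_space E)),
    linfty_norm (val x) <= rnorm x ;
  sc_unit_vector : forall j,
    nss_norm (sc_space (scalar_banach R s)) (unit_vector j) = 1 }.

Definition sc_banach (X : seq_class) (E : banach) : banach := bss_type (X E).

(* The sup norms below are taken in [\bar R], hence they are [+oo], and not a
   default value, on an unbounded map. *)
Definition opnorm (E F : banach) (u : E -> F) : \bar R :=
  ereal_sup [set (rnorm (u x))%:E | x in [set x : E | rnorm x <= 1]].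

Definition bilinear_norm (E1 E2 F : banach) (A : E1 -> E2 -> F) : \bar R :=
  ereal_sup [set (rnorm (A p.1 p.2))%:E |
    p in [set p : E1 * E2 | rnorm p.1 <= 1 /\ rnorm p.2 <= 1]].

Definition bounded_op (E F : banach) : set {linear E -> F} :=
  [set u | continuous u].
Arguments bounded_op {E F}.

Definition bounded_bilinear (E1 E2 F : banach) :
    set {bilinear E1 -> E2 -> F} :=
  [set A | continuous (fun p : E1 * E2 => A p.1 p.2)].
Arguments bounded_bilinear {E1 E2 F}.

Definition summing_op (X Y : seq_class) (E F : banach) :
    set {linear E -> F} :=
  [set u | bounded_op u /\
    forall x : sc_banach X E, (fun j => u (val x j)) \in nss_mem (Y F)].
Arguments summing_op X Y {E F}.

(* Meaningful when [u] is summing: otherwise [bss_of_seq] may return [0]. *)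
Definition induced_op (X Y : seq_class) (E F : banach) (u : {linear E -> F}) :
    sc_banach X E -> sc_banach Y F :=
  fun x => bss_of_seq (Y F) (fun j => u (val x j)).
Arguments induced_op X Y {E F} u.

Definition summing_norm (X Y : seq_class) (E F : banach)
    (u : {linear E -> F}) : \bar R :=
  opnorm (induced_op X Y u).
Arguments summing_norm X Y {E F} u.

Definition classB (X Y : seq_class) (F E : banach) : Prop :=
  @bounded_op E (sc_banach Y F) = summing_op X Y.

Definition classC (X Y : seq_class) (F E : banach) : Prop :=
  @bounded_op E F = summing_op X Y.

Definition iterated_seq (Y : seq_class) (F : banach) (a : nat -> nat -> F) :
    nat -> sc_banach Y F :=
  fun j1 => bss_of_seq (Y F) (a j1).
Arguments iterated_seq Y {F} a.

(* The [Y(F)]-valued sequence only makes sense once every row is in [Y(F)]. *)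
Definition bilinear_summing (X1 X2 Y : seq_class) (E1 E2 F : banach)
    (A : {bilinear E1 -> E2 -> F}) : Prop :=
  forall (x1 : sc_banach X1 E1) (x2 : sc_banach X2 E2),
    (forall j1, (fun j2 => A (val x1 j1) (val x2 j2)) \in nss_mem (Y F)) /\
    iterated_seq Y (fun j1 j2 => A (val x1 j1) (val x2 j2))
      \in nss_mem (Y (sc_banach Y F)).
Arguments bilinear_summing X1 X2 Y {E1 E2 F} A.

(* Meaningful when [A] is summing. *)
Definition induced_bilinear (X1 X2 Y : seq_class) (E1 E2 F : banach)
    (A : {bilinear E1 -> E2 -> F}) :
    sc_banach X1 E1 -> sc_banach X2 E2 -> sc_banach Y (sc_banach Y F) :=
  fun x1 x2 => bss_of_seq (Y (sc_banach Y F))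
    (iterated_seq Y (fun j1 j2 => A (val x1 j1) (val x2 j2))).
Arguments induced_bilinear X1 X2 Y {E1 E2 F} A.

Definition bilinear_summing_norm (X1 X2 Y : seq_class) (E1 E2 F : banach)
    (A : {bilinear E1 -> E2 -> F}) : \bar R :=
  bilinear_norm (induced_bilinear X1 X2 Y A).
Arguments bilinear_summing_norm X1 X2 Y {E1 E2 F} A.

End sequence_classes.

(* Main.v *)
From HB Require Import structures.
Require Import Defs.
From mathcomp Require Import all_boot all_order all_algebra.
From mathcomp Require Import all_classical all_reals all_analysis.
From mathcomp Require Import complex ring lra.

Set Implicit Arguments.
Unset Strict Implicit.
Unset Printing Implicit Defensive.

Import Order.TTheory GRing.Theory Num.Theory.
Import numFieldNormedType.Exports.

Local Open Scope classical_set_scope.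
Local Open Scope ring_scope.

(** Freeze a sequence [x2] in [X2(E2)] and let [u] send [e1] to the sequence
    [(A(e1, x2_j))_j].  Because [E2] is in [C(X2, Y, F)], every [A(e1, .)] is
    summing, so [u] is a linear map from [E1] to [Y(F)].  Once [u] is known to be
    continuous, [E1] in [B(X1, Y, F)] makes [u] summing, and [u] applied
    termwise to [x1] is exactly the iterated sequence
    [((A(x1_i, x2_j))_j)_i], which therefore lies in [Y(Y(F))].

    Continuity of [u] is the content of [row_operator].  It follows from the
    closed graph theorem ([closed_graph]): the norm of [Y(F)] dominates every
    coordinate, so a limit in [Y(F)] can only be the sequence of limits of
    coordinates, and these are given by the continuity of [A].  The closed
    graph theorem is proved for both scalar fields at once, by working with
    the real-valued norm [rnorm]; the proof is the classical one, a nested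
    balls argument ([somewhere_dense_sublevel]) followed by successive
    approximations.

    For the norms, with [x1] and [x2] in the unit balls, the norm of the
    iterated sequence is at most [C1 * ||u||], and [||u|| <= C2 * ||A||] since
    [u e1] is the image of [x2] under the operator induced by [A(e1, .)].
    Multiplying inequalities this way needs nonnegative constants.  A negative
    constant is possible only if all the operators that it bounds vanish, and
    then [||A|| = 0] ([bilinear_norm_eq0_of_op], [bilinear_norm_eq0_of_row]), so
    replacing each constant by its positive part keeps the hypotheses true
    ([summing_const_ge0]) and leaves the bound on the iterated sequence as it
    was. *)

(** * The real-valued norm *)

Section real_norm.
Context {R : realType} {s : scalar_kind}.
Local Notation K := (scalar_field R s).

(** The norms of the library are scalars; through this embedding of the reals an
    inequality between them becomes one between real numbers. *)
Definition ofR : R -> K :=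
  match s return R -> scalar_field R s with
  | real_scalars => fun x => x
  | complex_scalars => fun x => (x%:C)%C
  end.

Lemma ofR_re (x : K) : 0 <= x -> ofR (re x) = x.
Proof.
by rewrite /ofR; case: s x => //= x x0; apply: RRe_real; apply: ger0_real.
Qed.

Lemma ofRK : cancel ofR (@re R s).
Proof. by rewrite /ofR; case: s. Qed.

Lemma ler_ofR (x y : R) : (ofR x <= ofR y) = (x <= y).
Proof. by rewrite /ofR; case: s => //=; rewrite lecR. Qed.

Lemma ltr_ofR (x y : R) : (ofR x < ofR y) = (x < y).
Proof. by rewrite /ofR; case: s => //=; rewrite ltcR. Qed.

Lemma ofRD (x y : R) : ofR (x + y) = ofR x + ofR y.
Proof. by rewrite /ofR; case: s => //=; rewrite rmorphD. Qed.

Lemma ofRM (x y : R) : ofR (x * y) = ofR x * ofR y.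
Proof. by rewrite /ofR; case: s => //=; rewrite rmorphM. Qed.

Lemma ofR0 : ofR 0 = 0.
Proof. by rewrite /ofR; case: s. Qed.

Lemma ofR1 : ofR 1 = 1.
Proof. by rewrite /ofR; case: s. Qed.

Context {E : normedModType K}.
Implicit Types x y : E.

Lemma ofR_rnorm x : ofR (rnorm x) = `|x|.
Proof. exact: ofR_re. Qed.

Lemma rnorm_ge0 x : 0 <= rnorm x.
Proof. by rewrite -ler_ofR ofR0 ofR_rnorm. Qed.

Lemma rnorm0 : rnorm (0 : E) = 0.
Proof. by apply: (can_inj ofRK); rewrite ofR_rnorm normr0 ofR0. Qed.

Lemma rnorm_eq0 x : rnorm x = 0 -> x = 0.
Proof. by move=> x0; apply/normr0_eq0; rewrite -ofR_rnorm x0 ofR0. Qed.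

Lemma rnormN x : rnorm (- x) = rnorm x.
Proof. by rewrite /rnorm normrN. Qed.

Lemma rnorm_distC x y : rnorm (x - y) = rnorm (y - x).
Proof. by rewrite /rnorm distrC. Qed.

Lemma ler_rnormD x y : rnorm (x + y) <= rnorm x + rnorm y.
Proof. by rewrite -ler_ofR ofRD !ofR_rnorm ler_normD. Qed.

Lemma ler_rdist z x y : rnorm (x - y) <= rnorm (x - z) + rnorm (z - y).
Proof. by rewrite -(subrKA z x (-y)) ler_rnormD. Qed.

Lemma rnormZ (c : R) x : 0 <= c -> rnorm (ofR c *: x) = c * rnorm x.
Proof.
move=> c0; apply: (can_inj ofRK).
by rewrite ofRM !ofR_rnorm normrZ ger0_norm // -ofR0 ler_ofR.
Qed.

Lemma re_gt0 (e : K) : 0 < e -> 0 < re e.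
Proof. by move=> e0; rewrite -ltr_ofR ofR_re ?ofR0// ltW. Qed.

Lemma norm_lt_re x (e : K) : 0 < e -> (`|x| < e) = (rnorm x < re e).
Proof. by move=> e0; rewrite -ltr_ofR ofR_rnorm ofR_re // ltW. Qed.

Lemma cvg_rnormP (a : nat -> E) (l : E) :
  a @ \oo --> l <->
  forall e : R, 0 < e -> \forall n \near \oo, rnorm (l - a n) < e.
Proof.
split=> [/cvgrPdist_lt al e e0|al].
  have e0' : 0 < ofR e by rewrite -ofR0 ltr_ofR.
  by have := al _ e0'; apply: filterS => n /=; rewrite norm_lt_re // ofRK.
apply/cvgrPdist_lt => e e0.
by have := al _ (re_gt0 e0); apply: filterS => n; rewrite norm_lt_re.
Qed.

Lemma cvg_of_dist_le (a : nat -> E) (l : E) (r : nat -> R) :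
  (forall n, rnorm (l - a n) <= r n) -> r @ \oo --> (0 : R) -> a @ \oo --> l.
Proof.
move=> lar /cvgrPdist_lt r0; apply/cvg_rnormP => e /r0; apply: filterS => n.
rewrite /= sub0r normrN; apply: le_lt_trans; apply: le_trans (lar n) _.
exact: ler_norm.
Qed.

End real_norm.

(** * The closed graph theorem *)

Section complete.
Context {R : realType} {s : scalar_kind}.
Local Notation banach := (completeNormedModType (scalar_field R s)).

Lemma halving_cvg0 (r : nat -> R) : (forall n, 0 <= r n) ->
  (forall n, r n.+1 <= r n / 2) -> r @ \oo --> (0 : R).
Proof.
move=> r0 rS.
have rle n : r n <= geometric (r 0%N) 2^-1 n.
  elim: n => [|n IH] /=; first by rewrite expr0 mulr1.
  move: IH (rS n); rewrite /= exprSr; lra.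
apply: (@squeeze_cvgr _ _ _ _ (fun=> 0) (geometric (r 0%N) 2^-1)).
- by apply: nearW => n; rewrite r0 rle.
- exact: cvg_cst.
- by apply: cvg_geometric; rewrite ger0_norm ?invr_ge0 // invf_lt1 ?ltr1n.
Qed.

(** Completeness, with an error bound by the current step at every stage: nested
    balls need it to place the limit inside each of them, and successive
    approximations to bound the whole sum by its first term. *)
Lemma halving_steps_cvg (E : banach) (a : nat -> E) (r : nat -> R) :
  (forall n, 0 <= r n) -> (forall n, r n.+1 <= r n / 2) ->
  (forall n, rnorm (a n.+1 - a n) <= r n) ->
  exists l, a @ \oo --> l /\ forall n, rnorm (l - a n) <= 2 * r n.
Proof.
move=> r0 rS ar.
(* The telescoped bound: [r] at [n + k] is at most [2 r (n+k) - 2 r (n+k+1)]. *)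
have tail n k : rnorm (a (n + k)%N - a n) <= 2 * r n - 2 * r (n + k)%N.
  elim: k => [|k IH]; first by rewrite addn0 !subrr rnorm0.
  rewrite addnS; apply: le_trans (ler_rdist (a (n + k)%N) _ _) _.
  move: IH (ar (n + k)%N) (rS (n + k)%N); lra.
have tail_le n k : rnorm (a (n + k)%N - a n) <= 2 * r n.
  by have := tail n k; have := r0 (n + k)%N; lra.
have /cvg_ex[l al] : cvg (a @ \oo).
  apply/cauchy_cvgP/cauchy_exP => e e0.
  have /cvgrPdist_lt/(_ (re e / 2)) := halving_cvg0 r0 rS.
  have e0' := re_gt0 e0; case=> [|N _ /(_ N (leqnn N)) /=].
    by rewrite divr_gt0.
  rewrite sub0r normrN ger0_norm // => rN.
  exists (a N); exists N => // n /= Nn.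
  rewrite -ball_normE /= norm_lt_re // rnorm_distC -(subnKC Nn).
  by apply: le_lt_trans (tail_le _ _) _; lra.
exists l; split=> // n; apply/ler_addgt0Pr => e e0.
have /cvg_rnormP/(_ e e0)[N _ /(_ (n + N)%N (leq_addl _ _)) lN] := al.
apply: le_trans (ler_rdist (a (n + N)%N) _ _) _.
by rewrite addrC lerD // ltW.
Qed.

Lemma unit_ball_bounded_continuous (E F : banach) (u : {linear E -> F})
    (M : R) : (forall x, rnorm x <= 1 -> rnorm (u x) <= M) -> continuous u.
Proof.
move=> uM; apply/linear_bounded_continuous/ex_bound.
exists (ofR M); apply/nbhs_normP; exists 1 => //= x.
rewrite /= sub0r normrN => /ltW.
by rewrite -!ofR_rnorm -ofR1 !ler_ofR => /uM.
Qed.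

(** This is the Baire category theorem for the cover of [E] by the sublevel sets
    of [p]: if none were dense in a ball, one could nest balls avoiding the
    sublevel sets of larger and larger integer height, and [p] would exceed
    every integer at their common point. *)
Lemma somewhere_dense_sublevel (E : banach) (p : E -> R) :
  exists (M : R) (a : E) (d : R), 0 < d /\
    forall x, rnorm (x - a) < d -> forall e : R, 0 < e ->
      exists z, p z <= M /\ rnorm (x - z) < e.
Proof.
apply: contrapT => nowhere.
have escape (c : nat * (E * R)) : exists b : E * R, 0 < c.2.2 -> [/\ 0 < b.2,
    b.2 <= c.2.2 / 2, rnorm (b.1 - c.2.1) < c.2.2 / 4 &
    forall z, rnorm (b.1 - z) < b.2 -> c.1%:R < p z].
  case: c => n [a d] /=; apply: contrapT => noball; apply: nowhere.
  have d0 : 0 < d.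
    by apply: contrapT => d0; apply: noball; exists (a, d).
  (* The radius [d / 4] keeps the limit of the centers, at distance at most
     [2 * (d / 4)], strictly inside every ball. *)
  exists n%:R, a, (d / 4); split; first by rewrite divr_gt0.
  move=> x xa e e0; apply: contrapT => noz; apply: noball.
  exists (x, Num.min e (d / 2)) => _; split=> //=.
  - by rewrite lt_min e0 divr_gt0.
  - by rewrite ge_min lexx orbT.
  move=> z; rewrite lt_min => /andP[xz _]; rewrite ltNge.
  by apply/negP => pz; apply: noz; exists z.
have [f fP] := choice escape.
pose b := fix b n := if n is n'.+1 then f (n', b n') else (0 : E, 1 : R).
have b0 n : 0 < (b n).2.
  by elim: n => [|n IH] /=; [exact: ltr01 | have [] := fP (n, b n) IH].
have bP n : [/\ (b n.+1).2 <= (b n).2 / 2,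
    rnorm ((b n.+1).1 - (b n).1) < (b n).2 / 4 &
    forall z, rnorm ((b n.+1).1 - z) < (b n.+1).2 -> n%:R < p z].
  by have [] := fP (n, b n) (b0 n).
have [|||l [_ lb]] :=
    @halving_steps_cvg E (fun n => (b n).1) (fun n => (b n).2 / 4).
- by move=> n; rewrite divr_ge0 // ltW.
- by move=> n; have [] := bP n; lra.
- by move=> n; have [_ /ltW] := bP n.
have pl n : n%:R < p l.
  have [_ _] := bP n; apply; rewrite rnorm_distC.
  by have := lb n.+1; have := b0 n.+1; lra.
have := pl (Num.truncn (p l)).+1.
by apply/negP; rewrite -leNgt ltW // truncnS_gt.
Qed.

(** By linearity, the density near one point given by the nested balls moves to
    the origin, as a difference of two approximations, and then to every scale. *)
Lemma linear_dense_image_bound (E F : banach) (u : {linear E -> F}) :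
  exists M : R, 0 <= M /\ forall x (e : R), 0 < e ->
    exists z, rnorm (u z) <= M * rnorm x /\ rnorm (x - z) < e.
Proof.
have [M [a [d [d0 dense]]]] := somewhere_dense_sublevel (fun x => rnorm (u x)).
have M0 : 0 <= M.
  have [|z [uz _]] := dense a _ 1 ltr01; first by rewrite subrr rnorm0.
  exact: le_trans (rnorm_ge0 _) uz.
(* Vectors are rescaled to norm [d / 2], which costs [2 / d]; the difference of
   two elements of the sublevel set has image of norm at most [2 * M]. *)
exists (4 * M / d); split; first by rewrite divr_ge0 ?mulr_ge0 // ltW.
move=> x e e0; have [x0|x0] := eqVneq (rnorm x) 0.
  exists 0; rewrite linear0 rnorm0 x0 mulr0 (rnorm_eq0 x0) subrr rnorm0.
  by split.
have {}x0 : 0 < rnorm x by rewrite lt_neqAle eq_sym x0 rnorm_ge0.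
pose c := 2 * rnorm x / d.
have c0 : 0 < c by rewrite divr_gt0 // mulr_gt0.
have e0' : 0 < e / c / 2 by apply: divr_gt0 => //; apply: divr_gt0.
have [|z1 [uz1 z1P]] := dense (a + ofR c^-1 *: x) _ _ e0'.
  rewrite addrAC subrr add0r rnormZ ?invr_ge0 ?ltW // /c.
  by rewrite invf_div mulrAC -mulf_div divff ?gt_eqF // mulr1; lra.
have [|z2 [uz2 z2P]] := dense a _ _ e0'; first by rewrite subrr rnorm0.
exists (ofR c *: (z1 - z2)); split.
  rewrite linearZ linearB (rnormZ _ (ltW c0)).
  have /(ler_wpM2l (ltW c0)) := ler_rnormD (u z1) (- u z2).
  rewrite rnormN => /le_trans; apply.
  have -> : 4 * M / d * rnorm x = c * (M + M) by rewrite /c; field; lra.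
  by apply: ler_wpM2l; [exact: ltW | exact: lerD].
have -> : x - ofR c *: (z1 - z2) =
    ofR c *: ((a + ofR c^-1 *: x - z1) - (a - z2)).
  rewrite -{1}[x]scale1r -ofR1 -(divff (lt0r_neq0 c0)) ofRM -scalerA -scalerBr.
  congr (_ *: _); rewrite !opprB addrCA !addrA.
  rewrite [RHS]addrAC [X in _ = X + z2]addrAC [a + _]addrC addrK.
  by rewrite [z2 + _]addrC addrAC.
rewrite (rnormZ _ (ltW c0)) mulrC -ltr_pdivlMr //.
apply: le_lt_trans (ler_rnormD _ _) _; rewrite rnormN; lra.
Qed.

(** Approximating [x], then the remainder, and so on, writes [x] as a sum whose
    images form a geometrically convergent series; closedness of the graph
    identifies the sum of that series with [u x]. *)
Theorem closed_graph (E F : banach) (u : {linear E -> F}) :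
  (forall (e : nat -> E) (l : E) (y : F),
     e @ \oo --> l -> u \o e @ \oo --> y -> u l = y) ->
  continuous u.
Proof.
move=> closed; have [M [M0 approx]] := linear_dense_image_bound u.
apply: (@unit_ball_bounded_continuous _ _ _ (2 * M)) => x x1.
have pick (c : nat * E) : exists z : E,
    rnorm (u z) <= M * rnorm c.2 /\ rnorm (c.2 - z) < 2^-1 ^+ c.1.+1.
  by apply: approx; rewrite exprn_gt0 // invr_gt0.
have [f fP] := choice pick.
pose rest := fix rest n := if n is n'.+1 then rest n' - f (n', rest n') else x.
have rest_le n : rnorm (rest n) <= 2^-1 ^+ n.
  by case: n => [|n]; [rewrite expr0 | have [_ /ltW] := fP (n, rest n)].
have pow0 (c : R) : 0 <= c -> forall n, 0 <= c * 2^-1 ^+ n.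
  by move=> c0 n; rewrite mulr_ge0 ?exprn_ge0.
have powS (c : R) n : c * 2^-1 ^+ n.+1 <= c * 2^-1 ^+ n / 2.
  by rewrite exprSr mulrA.
pose S n := x - rest n.
have S_cvg : S @ \oo --> x.
  apply: (@cvg_of_dist_le _ _ _ _ _ (fun n => 1 * 2^-1 ^+ n)).
    by move=> n; rewrite /S opprB addrCA subrr addr0 mul1r.
  by apply: halving_cvg0; [exact: pow0 | exact: powS].
have uS_step n : rnorm (u (S n.+1) - u (S n)) <= M * 2^-1 ^+ n.
  rewrite -linearB; have -> : S n.+1 - S n = f (n, rest n).
    by rewrite /S /= !opprB addrC addrA subrK addrC subrK.
  have [+ _] := fP (n, rest n); move/le_trans; apply.
  by apply: ler_wpM2l => //=; exact: rest_le.
have [|||y [uS_cvg yM]] := @halving_steps_cvg F (u \o S) (fun n => M * 2^-1 ^+ n).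
- exact: pow0.
- exact: powS.
- exact: uS_step.
rewrite (closed _ _ _ S_cvg uS_cvg).
by have := yM 0%N; rewrite /= /S /= subrr linear0 subr0 expr0 mulr1.
Qed.

End complete.

(** * Sequence spaces and operator norms *)

Section sequence_spaces.
Context {R : realType} {s : scalar_kind}.
Local Notation banach := (completeNormedModType (scalar_field R s)).
Implicit Types (X Y : seq_class R s) (E F : banach).

Lemma val_bss_of_seq Y F (a : nat -> F) :
  a \in nss_mem (Y F) -> val (bss_of_seq (Y F) a) = a.
Proof. exact: insubdK. Qed.

Lemma rnorm_coord_le Y F (y : sc_banach Y F) j :
  rnorm (val y j : F) <= rnorm y.
Proof.
apply: le_trans (sc_linfty_norm y).
apply: ub_le_sup; last by exists j.
have [M [Mreal yM]] := sc_linfty (valP y).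
exists (re (M + 1)) => _ [i _ <-].
have yM1 : `|val y i : F| <= M + 1 by apply: yM => //; rewrite ltrDl.
by rewrite -(ler_ofR (s := s)) ofR_rnorm ofR_re // (le_trans _ yM1).
Qed.

(** The topology of [Y(F)] is finer than coordinatewise convergence; this is what
    makes graphs of operators into [Y(F)] closed. *)
Lemma coord_cvg Y F (y : nat -> sc_banach Y F) (l : sc_banach Y F) j :
  y @ \oo --> l -> (fun n => val (y n) j : F) @ \oo --> (val l j : F).
Proof.
move=> /cvg_rnormP yl; apply/cvg_rnormP => e /yl; apply: filterS => n.
exact/le_lt_trans/(rnorm_coord_le (l - y n)).
Qed.

Lemma opnorm_ub E F (u : E -> F) x :
  rnorm x <= 1 -> ((rnorm (u x))%:E <= opnorm u)%E.
Proof. by move=> x1; apply: ereal_sup_ubound; exists x. Qed.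

Lemma opnorm_ge0 E F (u : E -> F) : (0 <= opnorm u)%E.
Proof.
by apply: le_trans (opnorm_ub u (x := 0) _); rewrite ?lee_fin ?rnorm_ge0 ?rnorm0.
Qed.

Lemma opnorm_le E F (u : E -> F) (c : \bar R) :
  (forall x, rnorm x <= 1 -> ((rnorm (u x))%:E <= c)%E) -> (opnorm u <= c)%E.
Proof. by move=> uc; apply: ub_ereal_sup => _ [x x1 <-]; exact: uc. Qed.

Lemma bilinear_norm_ub E1 E2 F (A : E1 -> E2 -> F) x1 x2 :
  rnorm x1 <= 1 -> rnorm x2 <= 1 ->
  ((rnorm (A x1 x2))%:E <= bilinear_norm A)%E.
Proof. by move=> h1 h2; apply: ereal_sup_ubound; exists (x1, x2). Qed.

Lemma bilinear_norm_le E1 E2 F (A : E1 -> E2 -> F) (c : \bar R) :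
  (forall x1 x2, rnorm x1 <= 1 -> rnorm x2 <= 1 ->
     ((rnorm (A x1 x2))%:E <= c)%E) -> (bilinear_norm A <= c)%E.
Proof.
by move=> Ac; apply: ub_ereal_sup => _ [[x1 x2] [h1 h2] <-]; exact: Ac.
Qed.

Lemma bilinear_norm_ge0 E1 E2 F (A : E1 -> E2 -> F) : (0 <= bilinear_norm A)%E.
Proof.
by apply: le_trans (bilinear_norm_ub A (x1 := 0) (x2 := 0) _ _);
  rewrite ?lee_fin ?rnorm_ge0 ?rnorm0.
Qed.

Lemma summing_const_ge0 X Y E F (u : {linear E -> F}) (C : R) :
  (summing_norm X Y u <= C%:E * opnorm u)%E ->
  (summing_norm X Y u <= (Num.max C 0)%:E * opnorm u)%E.
Proof.
move=> /le_trans; apply; apply: lee_wpmul2r; first exact: opnorm_ge0.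
by rewrite lee_fin le_max lexx.
Qed.

(** A summing norm is nonnegative, so a negative constant can only bound it when
    the operator norm vanishes. *)
Lemma opnorm_eq0_of_neg_const X Y E F (u : {linear E -> F}) (C : R) : C < 0 ->
  (summing_norm X Y u <= C%:E * opnorm u)%E -> opnorm u = 0%E.
Proof.
move=> C0 /(le_trans (opnorm_ge0 _)) CC; apply/eqP; rewrite eq_le opnorm_ge0.
rewrite leNgt andbT; apply/negP => u0; move: CC.
by apply/negP; rewrite -ltNge nmule_rlt0.
Qed.

End sequence_spaces.

(** * The row operators of a bilinear operator *)

Section bilinear.
Context {R : realType} {s : scalar_kind}.
Local Notation banach := (completeNormedModType (scalar_field R s)).
Context {F E1 E2 : banach}.
Implicit Types (X Y : seq_class R s) (A : {bilinear E1 -> E2 -> F}).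

Lemma continuous_bilinearr A (e1 : E1) :
  bounded_bilinear A -> continuous (A e1).
Proof.
move=> cA e2.
apply: (@continuous_comp _ _ _ (fun e2 => (e1, e2)) (fun p => A p.1 p.2)).
  by apply: cvg_pair; [exact: cvg_cst | exact: cvg_id].
exact: cA.
Qed.

Lemma continuous_bilinearl A (e2 : E2) :
  bounded_bilinear A -> continuous (A ^~ e2).
Proof.
move=> cA e1.
apply: (@continuous_comp _ _ _ (fun e1 => (e1, e2)) (fun p => A p.1 p.2)).
  by apply: cvg_pair; [exact: cvg_id | exact: cvg_cst].
exact: cA.
Qed.

Lemma mem_row X2 Y A (x2 : sc_banach X2 E2) e1 :
  classC X2 Y F E2 -> bounded_bilinear A ->
  (fun j => A e1 (val x2 j)) \in nss_mem (Y F).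
Proof.
move=> hE2 cA.
have [_] : summing_op X2 Y (A e1 : {linear E2 -> F}); last exact.
by rewrite -hE2; exact: continuous_bilinearr.
Qed.

(** The hypothesis on [E2] only says that each row lies in [Y(F)]; that the row
    depends continuously on [e1] is the closed graph theorem, the graph being
    closed because convergence in [Y(F)] and continuity of [A] both determine
    the limit coordinate by coordinate. *)
Lemma row_operator X2 Y A (x2 : sc_banach X2 E2) :
  classC X2 Y F E2 -> bounded_bilinear A ->
  exists u : {linear E1 -> sc_banach Y F}, bounded_op u /\
    forall e1, u e1 = induced_op Y (A e1) x2.
Proof.
move=> hE2 cA; pose row e1 : sc_banach Y F := induced_op Y (A e1) x2.
have val_row e1 : val (row e1) = (fun j => A e1 (val x2 j)).
  by apply: val_bss_of_seq; exact: mem_row.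
have row_linear : linear row.
  move=> a e e'; apply: val_inj; rewrite linearP /= !val_row.
  by apply/funext => j; rewrite linearPl.
pose u : {linear E1 -> sc_banach Y F} :=
  HB.pack row (GRing.isLinear.Build _ _ _ _ row row_linear).
exists u; split=> //.
apply: closed_graph => e l y el rowy; apply: val_inj; apply/funext => j.
apply: (@cvg_unique _ (@norm_hausdorff _ F) ((fun n => A (e n) (val x2 j)) @ \oo)).
  rewrite /= val_row.
  exact: (cvg_comp _ _ el (@continuous_bilinearl A (val x2 j) cA l)).
have := coord_cvg (j := j) rowy.
by under eq_fun do rewrite /= val_row.
Qed.

Lemma opnorm_row_le X2 Y A (x2 : sc_banach X2 E2) (C : R) :
  bounded_bilinear A -> 0 <= C -> rnorm x2 <= 1 ->
  (forall v : {linear E2 -> F}, bounded_op v ->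
     (summing_norm X2 Y v <= C%:E * opnorm v)%E) ->
  (opnorm (fun e1 => induced_op Y (A e1) x2) <= C%:E * bilinear_norm A)%E.
Proof.
move=> cA C0 x21 vC; apply: opnorm_le => e1 e11.
apply: le_trans (opnorm_ub (induced_op Y (A e1)) x21) _.
apply: le_trans (vC (A e1) (@continuous_bilinearr A e1 cA)) _.
rewrite lee_wpmul2l ?lee_fin //; apply: opnorm_le => e2.
exact: bilinear_norm_ub.
Qed.

Lemma bilinear_norm_eq0_of_op X2 Y A (C : R) : bounded_bilinear A -> C < 0 ->
  (forall v : {linear E2 -> F}, bounded_op v ->
     (summing_norm X2 Y v <= C%:E * opnorm v)%E) ->
  bilinear_norm A = 0%E.
Proof.
move=> cA C0 vC; apply/le_anti; rewrite bilinear_norm_ge0 andbT.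
apply: bilinear_norm_le => e1 e2 _ e21.
have Ae1 := vC (A e1) (@continuous_bilinearr A e1 cA).
by rewrite -(opnorm_eq0_of_neg_const C0 Ae1); exact: opnorm_ub.
Qed.

(** Every vector [e2] is the first coordinate of a sequence of [X2(E2)], namely one
    that vanishes afterwards, so [A] vanishes once all row operators do. *)
Lemma bilinear_norm_eq0_of_row X1 X2 Y A (C : R) :
  classC X2 Y F E2 -> bounded_bilinear A -> C < 0 ->
  (forall u : {linear E1 -> sc_banach Y F}, bounded_op u ->
     (summing_norm X1 Y u <= C%:E * opnorm u)%E) ->
  bilinear_norm A = 0%E.
Proof.
move=> hE2 cA C0 uC; apply/le_anti; rewrite bilinear_norm_ge0 andbT.
apply: bilinear_norm_le => e1 e2 e11 _.
pose x2 : sc_banach X2 E2 :=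
  bss_of_seq (X2 E2) (fun j => if j is 0%N then e2 else 0).
have x20 : val x2 0%N = e2.
  by rewrite val_bss_of_seq //; apply: sc_c00; exists 1%N => // -[].
have [u [cu uE]] := row_operator x2 hE2 cA.
rewrite -(opnorm_eq0_of_neg_const C0 (uC u cu)).
apply: le_trans (opnorm_ub u e11); rewrite lee_fin -x20.
have := rnorm_coord_le (u e1) 0%N.
by rewrite uE val_bss_of_seq //; exact: mem_row.
Qed.

End bilinear.

(** * The main theorem *)

Theorem theorem5p1 (R : realType) (s : scalar_kind) (X1 X2 Y : seq_class R s)
    (F E1 E2 : completeNormedModType (scalar_field R s))
    (hE1 : classB X1 Y F E1) (hE2 : classC X2 Y F E2) :
  (forall A : {bilinear E1 -> E2 -> F},
     bounded_bilinear A -> bilinear_summing X1 X2 Y A) /\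
  (forall C1 C2 : R,
     (forall u : {linear E1 -> sc_banach Y F}, bounded_op u ->
        (summing_norm X1 Y u <= C1%:E * opnorm u)%E) ->
     (forall v : {linear E2 -> F}, bounded_op v ->
        (summing_norm X2 Y v <= C2%:E * opnorm v)%E) ->
     forall A : {bilinear E1 -> E2 -> F}, bounded_bilinear A ->
       (bilinear_summing_norm X1 X2 Y A
          <= (C1 * C2)%:E * bilinear_norm A)%E).
Proof.
split=> [A cA x1 x2|C1 C2 uC1 vC2 A cA].
  split=> [j1|]; first exact: mem_row.
  have [u [cu uE]] := row_operator x2 hE2 cA.
  have [_ /(_ x1)] : summing_op X1 Y u by rewrite -hE1.
  by under eq_fun do rewrite uE.
(* Either both constants are nonnegative, or [||A|| = 0]. *)
have [C10 C20 A0] : [/\ 0 <= Num.max C1 0, 0 <= Num.max C2 0 &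
    ((C1 * C2)%:E * bilinear_norm A =
     (Num.max C1 0 * Num.max C2 0)%:E * bilinear_norm A)%E].
  split; rewrite ?le_max ?lexx ?orbT //.
  have [C10|C10] := ltP C1 0.
    by rewrite (bilinear_norm_eq0_of_row hE2 cA C10 uC1) !mule0.
  have [C20|C20] := ltP C2 0 => //.
  by rewrite (bilinear_norm_eq0_of_op cA C20 vC2) !mule0.
rewrite {}A0 EFinM -muleA; apply: bilinear_norm_le => x1 x2 x11 x21.
have [u [cu uE]] := row_operator x2 hE2 cA.
have -> : induced_bilinear Y A x1 x2 = induced_op Y u x1.
  congr bss_of_seq; apply/funext => j1; exact/esym/uE.
apply: le_trans (opnorm_ub (induced_op Y u) x11) _.
apply: le_trans (summing_const_ge0 (uC1 u cu)) _.
rewrite lee_wpmul2l ?lee_fin //.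
rewrite (_ : (u : E1 -> _) = fun e1 => induced_op Y (A e1) x2); last exact/funext.
by apply: opnorm_row_le => // v /vC2; exact: summing_const_ge0.
Qed.
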